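(* Let $m\in\mathbb{Z}_+$ and let $B_0,\ldots,B_m$ be closed linear operators from $H$ to $H'$ with domains $\mathcal{D}(B_j)\subset H$ such that: $e_n\in\bigcap_{j=0}^m\mathcal{D}(B_j)$ for every $n\in M$; $(B_je_{n'},B_je_{n''})_{H'}=0$ for all $j\in\{0,\ldots,m\}$ and all $n',n''\in M$ with $n'\neq n''$; and there exist $j_0\in\{0,\ldots,m\}$ and $n_0\in M$ with $B_{j_0}e_{n_0}\neq 0$. Let $X$ be a normed space over $\mathbb{C}$, $A:H\to X$ a linear operator with domain $\mathcal{D}(A)\subset H$, and $f\in X^*$ a bounded linear functional such that: $e_n\in\mathcal{D}(A)$ for every $n\in M$; there exists $n_0\in M$ with $\langle f,Ae_{n_0}\rangle\neq 0$; and the functional $g_f(x)=\langle f,Ax\rangle$ from $H$ to $\mathbb{C}$ with domain $\mathcal{D}(A)$ is closable. Assume that $$\widetilde{\sum_{n\in M}}\frac{|\langle f,Ae_n\rangle|^2}{b_{n,\mathbf{1}}}<\infty .$$ Then for every $\mathbf{h}\in\mathbb{R}_+^{m+1}$ and every $x\in\mathcal{D}(A)\cap H_{\mathbf{B}}$ the following inequality holds: $$|\langle f,Ax\rangle|\leqslant\left(\widetilde{\sum_{n\in M}}\frac{|\langle f,Ae_n\rangle|^2}{b_{n,\mathbf{h}}}\right)^{1/2}\|x\|_{\mathbf{B},\mathbf{h}} .$$ The inequality is sharp (for each $\mathbf{h}$ the constant cannot be replaced by a smaller one). Moreover, the sequence $$x_{\mathbf{h},N}:=\widetilde{\sum_{n\in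 M_N}}\frac{\overline{\langle f,Ae_n\rangle}}{b_{n,\mathbf{h}}}\,e_n,\qquad N\in\mathbb{N},$$ is extremal, i.e. $\|x_{\mathbf{h},N}\|_{\mathbf{B},\mathbf{h}}\neq 0$ for all sufficiently large $N$ and $|\langle f,Ax_{\mathbf{h},N}\rangle|/\|x_{\mathbf{h},N}\|_{\mathbf{B},\mathbf{h}}$ tends to the constant of the inequality as $N\to\infty$.
   Context: $\mathbb{R}_+=(0,+\infty)$; $\mathbb{Z}_+$ is the set of non-negative integers; $\mathbf{1}=(1,\ldots,1)$. $H$ is a separable Hilbert space over $\mathbb{C}$ with orthonormal basis $\{e_n\}_{n\in M}$, $M$ finite or countable; $x_n:=(x,e_n)_H$. $\{M_N\}_{N=1}^\infty$ is a fixed sequence of nested finite subsets of $M$ with union $M$, and $\sum_{n\in M}a_n:=\lim_{N\to\infty}\sum_{n\in M_N}a_n$. $H'$ is a Hilbert space over $\mathbb{C}$. For non-negative sequences $\{a_n\},\{b_n\}$, the sum $\widetilde{\sum}_{n\in M}\frac{a_n}{b_n}$ equals $+\infty$ if there is $n_0$ with $a_{n_0}\neq0$ and $b_{n_0}=0$, and otherwise equals $\sum_{n\in M:\,b_n\neq0}\frac{a_n}{b_n}$ (an empty sum is $0$). In $\widetilde{\sum}$ with vector terms, the terms with zero numerator and zero denominator are likewise omitted. For $\mathbf{h}=(h_0,\ldots,h_m)\in\mathbb{R}_+^{m+1}$: $b_{n,\mathbf{h}}:=\sum_{j=0}^m h_j\|B_je_n\|_{H'}^2$. Further, $H_{\mathbf{B}}:=\{x\in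 H:\ \sum_{n\in M}|x_n|^2\|B_je_n\|_{H'}^2<\infty,\ j=0,\ldots,m\}$ and $\|x\|_{\mathbf{B},\mathbf{h}}:=\left(\sum_{n\in M}|x_n|^2b_{n,\mathbf{h}}\right)^{1/2}$ for $x\in H_{\mathbf{B}}$ (a seminorm). An operator is closable if the closure of its graph is the graph of an operator. *)

(* Defs.v *)
(* The field of complex numbers is R[i], for R : realType. *)
From HB Require Import structures.
From mathcomp Require Import all_boot all_order all_algebra sesquilinear.
From mathcomp Require Import finmap complex.
From mathcomp Require Import all_classical all_reals all_analysis.
Import Order.TTheory GRing.Theory Num.Theory.
Import numFieldNormedType.Exports.

Set Implicit Arguments.
Unset Strict Implicit.
Unset Printing Implicit Defensive.

Local Open Scope classical_set_scope.
Local Open Scope ring_scope.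

(* The inner product is linear in its first argument and conjugate-linear in
   its second one. *)
HB.mixin Record CompleteNormedModule_isHilbert (R : realType) H
    & CompleteNormedModule R[i] H := {
  inner : {dot H for Num.conj} ;
  inner_norm : forall x : H, inner x x = `|x| ^+ 2
}.

#[short(type="hilbertType")]
HB.structure Definition Hilbert (R : realType) :=
  { H of CompleteNormedModule R[i] H & CompleteNormedModule_isHilbert R H }.

(* Norms over R[i] take values in R[i], in fact in its nonnegative reals;
   rnorm is the same norm with values in R. *)
Definition rnorm (R : realType) (V : normedZmodType R[i]) (x : V) : R :=
  complex.Re `|x|.

(* A linear operator whose domain is a linear subspace of V. The values of
   opfun outside opdom are irrelevant. *)
Record linop (K : pzRingType) (V W : lmodType K) := LinOp {
  opdom : set V ;
  opfun :> V -> W ;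
  opdom0 : opdom 0 ;
  opdomP : forall a u v, opdom u -> opdom v -> opdom (a *: u + v) ;
  opfunP : forall a u v, opdom u -> opdom v ->
    opfun (a *: u + v) = a *: opfun u + opfun v
}.

Definition opgraph (K : pzRingType) (V W : lmodType K) (T : linop V W) :
    set (V * W) :=
  [set p | opdom T p.1 /\ T p.1 = p.2].

Definition closed_op (K : numFieldType) (V W : normedModType K)
    (T : linop V W) : Prop :=
  closed (opgraph T).

Definition closable (K : numFieldType) (V W : normedModType K)
    (T : linop V W) : Prop :=
  exists S : linop V W, closure (opgraph T) = opgraph S.

Section Compose.
Context (K : pzRingType) (V W Z : lmodType K).
Context (f : {linear W -> Z}) (A : linop V W).

Lemma comp_opP a u v : opdom A u -> opdom A v ->
  f (A (a *: u + v)) = a *: f (A u) + f (A v).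
Proof. by move=> Au Av; rewrite opfunP// linearP. Qed.

Definition comp_op : linop V Z :=
  @LinOp K V Z (opdom A) (fun x => f (A x)) (opdom0 A) (@opdomP _ _ _ A) comp_opP.

End Compose.

Definition orthonormal_basis (R : realType) (H : hilbertType R) (M : countType)
    (e : M -> H) : Prop :=
  (forall n n' : M, inner (e n) (e n') = (n == n')%:R) /\
  closure [set x | exists (F : {fset M}) (c : M -> R[i]),
                     x = \sum_(n <- F) c n *: e n] = setT.

(* Nonnegative series are summed in [0, +oo] along the exhaustion M_. *)
Definition sumM (R : realType) (M : countType) (M_ : nat -> {fset M})
    (P : pred M) (a : M -> R) : \bar R :=
  limn (fun N => \sum_(n <- M_ N | P n) (a n)%:E)%E.

Definition tsum (R : realType) (M : countType) (M_ : nat -> {fset M})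
    (a b : M -> R) : \bar R :=
  if `[< exists n0, a n0 != 0 /\ b n0 = 0 >] then +oo%E
  else sumM M_ [pred n | b n != 0] (fun n => a n / b n).

Section Families.
Context (R : realType) (H H' : hilbertType R) (M : countType).
Context (M_ : nat -> {fset M}) (e : M -> H).
Context (m : nat) (B : 'I_m.+1 -> linop H H').

Definition bcoef (h : 'I_m.+1 -> R) (n : M) : R :=
  \sum_(j < m.+1) h j * rnorm (B j (e n)) ^+ 2.

Definition spaceB : set H :=
  [set x | forall j : 'I_m.+1,
    (sumM M_ predT (fun n => rnorm (inner x (e n)) ^+ 2 *
                             rnorm (B j (e n)) ^+ 2)%R < +oo)%E].

(* On spaceB the sum is finite, so that fine loses nothing. *)
Definition seminormB (h : 'I_m.+1 -> R) (x : H) : R :=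
  Num.sqrt (fine (sumM M_ predT
    (fun n => rnorm (inner x (e n)) ^+ 2 * bcoef h n))).

Context (X : normedModType R[i]) (A : linop H X) (f : {linear X -> R[i]^o}).

Definition fA_tsum (h : 'I_m.+1 -> R) : \bar R :=
  tsum M_ (fun n => rnorm (f (A (e n))) ^+ 2) (bcoef h).

(* The omitted terms have zero denominator; their numerator also vanishes as
   soon as fA_tsum h is finite. *)
Definition extremal_seq (h : 'I_m.+1 -> R) (N : nat) : H :=
  \sum_(n <- M_ N | bcoef h n != 0)
    ((f (A (e n)) : R[i])^* / (bcoef h n)%:C%C) *: e n.

End Families.

(* Main.v *)
(* A closable functional is bounded, because the closure of its graph cannot
   contain both (0, 0) and (0, 1). Hence g := f \o A satisfies
   g x = lim g (x_N), where x_N is the orthogonal projection of x onto the span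
   of the e_n, n \in M_ N, and the Cauchy-Schwarz inequality bounds g (x_N) by
   the N-th partial sums of the two series. On the extremal sequence both
   |g (x_ N)| and the squared seminorm are equal to the N-th partial sum of the
   series defining the constant, which makes the inequality sharp. *)
Require Import Defs.
From HB Require Import structures.
From mathcomp Require Import all_boot all_order all_algebra sesquilinear.
From mathcomp Require Import finmap complex.
From mathcomp Require Import ring.
From mathcomp Require Import all_classical all_reals all_analysis.
Import Order.TTheory GRing.Theory Num.Theory.
Import numFieldNormedType.Exports.

Set Implicit Arguments.
Unset Strict Implicit.
Unset Printing Implicit Defensive.

Local Open Scope classical_set_scope.
Local Open Scope ring_scope.

(** * Real-valued norms over [R[i]] *)

Section RealNorm.
Context {R : realType}.
Implicit Type V : normedZmodType R[i].

Lemma rnormE V (x : V) : (rnorm x)%:C%C = `|x|.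
Proof. by rewrite /rnorm RRe_real// ger0_real. Qed.

Lemma rnorm_ge0 V (x : V) : 0 <= rnorm x.
Proof. by rewrite -ler0c rnormE. Qed.

Lemma rnorm_eq0 V (x : V) : (rnorm x == 0) = (x == 0).
Proof. by rewrite -[RHS]normr_eq0 -rnormE fmorph_eq0. Qed.

Lemma rnorm0 V : rnorm (0 : V) = 0.
Proof. by apply/eqP; rewrite rnorm_eq0. Qed.

Lemma ler_rnormD V (x y : V) : rnorm (x + y) <= rnorm x + rnorm y.
Proof. by rewrite -lecR rmorphD/= !rnormE ler_normD. Qed.

Lemma ler_rnorm_sum V I (s : seq I) (F : I -> V) :
  rnorm (\sum_(i <- s) F i) <= \sum_(i <- s) rnorm (F i).
Proof.
rewrite -lecR rmorph_sum/= rnormE (le_trans (ler_norm_sum _ _ _))//.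
by under [leRHS]eq_bigr do rewrite rnormE.
Qed.

Lemma rnormM (x y : R[i]) : rnorm (x * y) = rnorm x * rnorm y.
Proof. by apply: complexI; rewrite rmorphM/= !rnormE normrM. Qed.

Lemma rnormC (x : R) : 0 <= x -> rnorm x%:C%C = x.
Proof. by move=> x0; apply: complexI; rewrite rnormE ger0_norm ?ler0c. Qed.

Lemma rnormJ (x : R[i]) : rnorm x^* = rnorm x.
Proof. by apply: complexI; rewrite !rnormE norm_conjC. Qed.

Lemma mulcJ_rnorm (x : R[i]) : x^* * x = (rnorm x ^+ 2)%:C%C.
Proof. by rewrite rmorphXn/= rnormE normCK mulrC. Qed.

End RealNorm.

(** Lagrange's identity: twice the difference of the two sides is the double sum of the squares
    [(u i * v j - u j * v i) ^+ 2]. *)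
Lemma sum_CauchySchwarz (R : realFieldType) I (s : seq I) (u v : I -> R) :
  (\sum_(i <- s) u i * v i) ^+ 2 <=
  (\sum_(i <- s) u i ^+ 2) * \sum_(i <- s) v i ^+ 2.
Proof.
have -> : (\sum_(i <- s) u i * v i) ^+ 2 =
    \sum_(i <- s) \sum_(j <- s) u i * v i * (u j * v j).
  by rewrite expr2 big_distrlr.
have E : (\sum_(i <- s) u i ^+ 2) * (\sum_(i <- s) v i ^+ 2) =
    \sum_(i <- s) \sum_(j <- s) u i ^+ 2 * v j ^+ 2.
  by rewrite big_distrlr.
have E' : (\sum_(i <- s) u i ^+ 2) * (\sum_(i <- s) v i ^+ 2) =
    \sum_(i <- s) \sum_(j <- s) u j ^+ 2 * v i ^+ 2.
  by rewrite E exchange_big.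
rewrite -(ler_pMn2r (isT : (0 < 2)%N)) [leRHS]mulr2n {1}E E'.
rewrite -big_split/= -sumrMnl ler_sum// => i _.
rewrite -big_split/= -sumrMnl ler_sum// => j _.
rewrite -subr_ge0 (_ : _ - _ = (u i * v j - u j * v i) ^+ 2) ?sqr_ge0//; ring.
Qed.

(** * Series of nonnegative terms along the exhaustion *)

Section SumM.
Context {R : realType} {M : countType} {M_ : nat -> {fset M}}.
Hypothesis M_nested : forall N, (M_ N `<=` M_ N.+1)%fset.

Lemma nested_subset N N' : (N <= N')%N -> (M_ N `<=` M_ N')%fset.
Proof.
move=> /subnK <-; elim: (N' - N)%N => [|k IH]; first by rewrite add0n.
by rewrite addSn (fsubset_trans IH).
Qed.

Section Nonneg.
Variable a : M -> R.
Hypothesis a_ge0 : forall n, 0 <= a n.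

Lemma le_sum_nested N N' : (N <= N')%N ->
  \sum_(n <- M_ N) a n <= \sum_(n <- M_ N') a n.
Proof.
move=> /nested_subset NN'.
(* Setting the terms to 0 outside [M_ N] lets both sums run over [M_ N'] and be compared
   termwise. *)
have -> : \sum_(n <- M_ N) a n =
          \sum_(n <- M_ N) (if n \in M_ N then a n else 0).
  by rewrite !big_seq; apply: eq_bigr => n ->.
rewrite (big_fset_incl _ NN') ?ler_sum// => [n _|n _ /negbTE->//].
by case: ifP.
Qed.

(** The partial sums are nondecreasing, so the [limn] in [sumM] is a true limit and not a default
    value. *)
Lemma sumM_cvg : (\sum_(n <- M_ N) a n)%:E @[N --> \oo] --> sumM M_ predT a.
Proof.
rewrite /sumM; under [X in limn X]eq_fun do rewrite sumEFin.
apply: ereal_nondecreasing_is_cvgn => N N' NN'.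
by rewrite lee_fin le_sum_nested.
Qed.

Lemma sumM_ub N : ((\sum_(n <- M_ N) a n)%:E <= sumM M_ predT a)%E.
Proof.
apply: (cvge_to_ge sumM_cvg); near=> N'.
by rewrite lee_fin le_sum_nested//; near: N'; exact: nbhs_infty_ge.
Unshelve. all: by end_near. Qed.

Lemma sumM_lub (C : R) : (forall N, \sum_(n <- M_ N) a n <= C) ->
  (sumM M_ predT a <= C%:E)%E.
Proof.
by move=> aC; apply: (cvge_to_le sumM_cvg); near=> N; rewrite lee_fin.
Unshelve. all: by end_near. Qed.

Lemma sumM_ge0 : (0 <= sumM M_ predT a)%E.
Proof. by rewrite (le_trans _ (sumM_ub 0))// lee_fin sumr_ge0. Qed.

Lemma sumM_fineK : (sumM M_ predT a < +oo)%E ->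
  (fine (sumM M_ predT a))%:E = sumM M_ predT a.
Proof. by move=> a_lt; rewrite fineK// ge0_fin_numE// sumM_ge0. Qed.

Lemma sumM_supp N : (forall n, n \notin M_ N -> a n = 0) ->
  sumM M_ predT a = (\sum_(n <- M_ N) a n)%:E.
Proof.
move=> a0; apply/eqP; rewrite eq_le sumM_ub andbT sumM_lub// => N'.
have [/le_sum_nested//|/ltnW/nested_subset NN'] := leqP N' N.
by rewrite (big_fset_incl _ NN')// => n _ /a0.
Qed.

End Nonneg.

Lemma sumM_mkcond P (a : M -> R) :
  sumM M_ P a = sumM M_ predT (fun n => if P n then a n else 0).
Proof.
rewrite /sumM; congr (limn _); apply/funext => N.
by rewrite big_mkcond/=; apply: eq_bigr => n _; case: ifP.
Qed.

End SumM.

(** * Linear operators with a domain, and closable functionals *)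

Lemma linop_sum (K : pzRingType) (V W : lmodType K) (T : linop V W)
    (I : Type) (s : seq I) (c : I -> K) (v : I -> V) :
  (forall i, opdom T (v i)) ->
  opdom T (\sum_(i <- s) c i *: v i) /\
  T (\sum_(i <- s) c i *: v i) = \sum_(i <- s) c i *: T (v i).
Proof.
move=> Tv; elim: s => [|i s [IHd IH]].
  rewrite !big_nil; split; first exact: opdom0.
  (* [T 0 = 0] is not a field of [linop]; it follows by cancellation from linearity at
     [1 *: 0 + 0]. *)
  have := opfunP (1 : K) (opdom0 T) (opdom0 T).
  rewrite !scale1r addr0 => /eqP.
  by rewrite -[eqbLHS]addr0 (inj_eq (addrI _)) eq_sym => /eqP.
by rewrite !big_cons; split; [exact: opdomP|rewrite opfunP// IH].
Qed.

Lemma linopB (K : pzRingType) (V W : lmodType K) (T : linop V W) x y :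
  opdom T x -> opdom T y -> opdom T (x - y) /\ T (x - y) = T x - T y.
Proof.
move=> Tx Ty; rewrite addrC -scaleN1r; split; first exact: opdomP.
by rewrite opfunP// scaleN1r addrC.
Qed.

Lemma linopZ (K : pzRingType) (V W : lmodType K) (T : linop V W) a x :
  opdom T x -> opdom T (a *: x) /\ T (a *: x) = a *: T x.
Proof.
by move=> Tx; have := @linop_sum _ _ _ T _ [:: tt] (fun=> a) (fun=> x);
  rewrite !big_seq1; apply.
Qed.

(* If the bound fails, [T] takes the value 1 on vectors of arbitrarily small
   norm, so that (0, 1) lies in the closure of its graph. *)
Lemma closable_functional_bounded (K : numFieldType) (V : normedModType K)
    (T : linop V K^o) : closable T ->
  exists2 d : K, 0 < d & forall x, opdom T x -> d * `|T x| <= `|x|.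
Proof.
move=> [S clT].
(* By homogeneity, dividing [x] by [T x] reduces the bound to vectors on which [T] takes the value
   1. *)
suff [d d0 Td] : exists2 d : K, 0 < d &
    forall x, opdom T x -> T x = 1 :> K -> d <= `|x|.
  exists d => // x Tx; have [->|Tx0] := eqVneq (T x : K) 0.
    by rewrite normr0 mulr0.
  have [Ty Ey] := linopZ ((T x : K)^-1) Tx.
  have := Td _ Ty; rewrite Ey => /(_ (mulVf Tx0)).
  by rewrite normrZ normfV mulrC ler_pdivlMr ?normr_gt0.
apply: contrapT => noT.
have graph0 : opgraph S (0, 0).
  rewrite -clT; apply: subset_closure; split; first exact: opdom0.
  have := (linopZ 0 (opdom0 T)).2.
  by rewrite !scale0r.
suff : opgraph S (0, 1 : K^o).
  by case=> _ /= S1; case: graph0 => _ /=; rewrite S1 => /eqP; rewrite oner_eq0.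
rewrite -clT => U [/= [U1 U2] [/= nU1 nU2] U12].
have /nbhs_normP[d /= d0 dU1] := nU1.
have [x [Tx T1 xd]] : exists x, [/\ opdom T x, T x = 1 :> K & `|x| < d].
  apply: contrapT => nox; apply: noT; exists d => // x Tx T1.
  rewrite real_leNgt// ?gtr0_real//; apply/negP => xd; apply: nox.
  by exists x.
exists (x, 1); split; first by split.
apply: U12; split => /=; last exact: nbhs_singleton.
by apply: dU1; rewrite /ball_/= sub0r normrN.
Qed.

(** * Orthogonal projections onto finitely many basis vectors *)

Section Projection.
Context {R : realType} {H : hilbertType R} {M : countType}.

Definition proj (e : M -> H) (F : {fset M}) (x : H) : H :=
  \sum_(n <- F) inner x (e n) *: e n.

Context {e : M -> H}.
Hypothesis e_basis : orthonormal_basis e.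

Lemma inner_sum_basis (F : {fset M}) (c : M -> R[i]) n :
  inner (\sum_(k <- F) c k *: e k) (e n) = if n \in F then c n else 0.
Proof.
rewrite linear_sumlz; under eq_bigr do rewrite linearZl_LR/= e_basis.1.
case: ifP => nF.
  rewrite (big_fsetD1 n)//= eqxx mulr1 big_seq big1 ?addr0// => k.
  by rewrite !inE => /andP[/negbTE-> _]; rewrite mulr0.
rewrite big_seq big1// => k kF; case: eqP => [kn|]; last by rewrite mulr0.
by rewrite -kn kF in nF.
Qed.

(** Best approximation: [x - proj e F x] is orthogonal to the span of the [e n] with [n] in [F],
    which contains the competitor, so Pythagoras applies. *)
Lemma rnorm_subproj_le (A F : {fset M}) (c : M -> R[i]) x : (A `<=` F)%fset ->
  rnorm (x - proj e F x) <= rnorm (x - \sum_(n <- A) c n *: e n).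
Proof.
move=> AF; rewrite -lecR !rnormE.
(* Coordinates of the projection minus the competitor, whose coefficients are extended by 0 from [A]
   to [F]. *)
pose d n := inner x (e n) - (if n \in A then c n else 0).
have yE : x - \sum_(n <- A) c n *: e n =
    (x - proj e F x) + \sum_(n <- F) d n *: e n.
  have -> : \sum_(n <- A) c n *: e n =
      \sum_(n <- F) (if n \in A then c n else 0) *: e n.
    rewrite -(big_fset_incl _ AF); last by move=> n _ /negbTE->; rewrite scale0r.
    by rewrite !big_seq; apply: eq_bigr => n ->.
  under [in RHS]eq_bigr do rewrite scalerBl.
  by rewrite sumrB addrA subrK.
have orth : inner (x - proj e F x) (\sum_(n <- F) d n *: e n) = 0.
  rewrite linear_sumr big_seq big1// => n nF.
  transitivity ((d n)^* * (inner x (e n) - inner (proj e F x) (e n))).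
    by rewrite linearZr_LR linearBl.
  by rewrite inner_sum_basis nF subrr mulr0.
rewrite -(@ler_pXn2r _ 2)// ?nnegrE// -!inner_norm yE (hnormDd orth).
by rewrite lerDl dnorm_ge0.
Qed.

(** Density gives a finite combination close to [x]. Its index set lies in a single [M_ N], and the
    projection onto that span is at least as close. *)
Lemma proj_cvg (M_ : nat -> {fset M})
  (M_nested : forall N, (M_ N `<=` M_ N.+1)%fset)
  (M_union : forall n : M, exists N, n \in M_ N) x (eps : R) : 0 < eps ->
  exists N, rnorm (x - proj e (M_ N) x) < eps.
Proof.
move=> eps0.
have : closure [set x | exists (F : {fset M}) (c : M -> R[i]),
                  x = \sum_(n <- F) c n *: e n] x by rewrite e_basis.2.
move=> /(_ (ball x eps%:C%C)) [|_ [[A [c ->]]]].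
  by apply: nbhsx_ballx; rewrite ltcR.
rewrite -ball_normE /ball_/= -rnormE ltcR => xc.
have [N AN] : exists N, (A `<=` M_ N)%fset.
  elim/fset1U_rect : A {xc} => [|n A _ [N AN]].
    by exists 0%N; rewrite fsub0set.
  have [N' nN'] := M_union n; exists (maxn N N').
  rewrite fsubUset fsub1set (fsubset_trans AN) ?nested_subset ?leq_maxl// andbT.
  by apply: fsubsetP nN'; rewrite nested_subset ?leq_maxr.
by exists N; rewrite (le_lt_trans _ xc)// rnorm_subproj_le.
Qed.

End Projection.

(** * The sum of quotients with its convention on zero denominators *)

Section Tsum.
Context {R : realType} {M : countType} (M_ : nat -> {fset M}).

Lemma tsum_lty (a b : M -> R) n : (tsum M_ a b < +oo)%E -> b n = 0 -> a n = 0.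
Proof.
rewrite /tsum; case: asboolP => // ab _ bn; apply/eqP/negPn/negP => an.
by apply: ab; exists n.
Qed.

(* The terms omitted from [tsum] vanish here because x / 0 = 0. *)
Lemma tsumE (a b : M -> R) : (forall n, b n = 0 -> a n = 0) ->
  tsum M_ a b = sumM M_ predT (fun n => a n / b n).
Proof.
move=> ab; rewrite /tsum asboolF; last first.
  by move=> [n [an /ab]]; exact/eqP.
rewrite sumM_mkcond; congr sumM; apply/funext => n /=.
by case: eqVneq => //= ->; rewrite invr0 mulr0.
Qed.

End Tsum.

(** * The weights and the seminorm *)

Section Seminorm.
Context {R : realType} {H H' : hilbertType R} {M : countType}.
Context {M_ : nat -> {fset M}} {e : M -> H} {m : nat}.
Context {B : 'I_m.+1 -> linop H H'} {h : 'I_m.+1 -> R}.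
Hypothesis M_nested : forall N, (M_ N `<=` M_ N.+1)%fset.
Hypothesis e_basis : orthonormal_basis e.
Hypothesis h_gt0 : forall j, 0 < h j.

Local Notation b := (bcoef e B h).

Lemma bcoef_ge0 n : 0 <= b n.
Proof. by apply: sumr_ge0 => j _; rewrite mulr_ge0 ?sqr_ge0 ?ltW. Qed.

(** Each [h j] times the sum of all inverses is at least [h j * (h j)^-1 = 1]. This carries the
    hypothesis, stated for unit weights, over to [h]. *)
Lemma bcoef1_le n : bcoef e B (fun=> 1) n <= (\sum_j (h j)^-1) * b n.
Proof.
rewrite mulr_sumr ler_sum// => j _; rewrite [leRHS]mulrA ler_wpM2r ?sqr_ge0//.
rewrite -ler_pdivrMr// mul1r (bigD1 j)//= lerDl sumr_ge0// => i _.
by rewrite invr_ge0 ltW.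
Qed.

Let term_ge0 x n : 0 <= rnorm (inner x (e n)) ^+ 2 * b n.
Proof. by rewrite mulr_ge0 ?sqr_ge0 ?bcoef_ge0. Qed.

Lemma seminormB_ub x N : spaceB M_ e B x ->
  \sum_(n <- M_ N) rnorm (inner x (e n)) ^+ 2 * b n <=
  seminormB M_ e B h x ^+ 2.
Proof.
move=> xB; pose t n := rnorm (inner x (e n)) ^+ 2 * b n.
have t_ge0 n : 0 <= t n by exact: term_ge0.
(* The [fine] in [seminormB] would turn an infinite sum into 0, so finiteness comes first: the
   series is dominated by the combination, with coefficients [h j], of the finite series defining
   [spaceB]. *)
have t_lty : (sumM M_ predT t < +oo)%E.
  pose s j n := rnorm (inner x (e n)) ^+ 2 * rnorm (B j (e n)) ^+ 2.
  have s_ge0 j n : 0 <= s j n by rewrite mulr_ge0 ?sqr_ge0.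
  apply: (@le_lt_trans _ _ (\sum_j h j * fine (sumM M_ predT (s j)))%:E).
    apply: sumM_lub => // N'.
    have -> : \sum_(n <- M_ N') t n = \sum_j h j * \sum_(n <- M_ N') s j n.
      under [RHS]eq_bigr do rewrite mulr_sumr.
      rewrite exchange_big/=; apply: eq_bigr => n _.
      by rewrite /t /bcoef mulr_sumr; apply: eq_bigr => j _; rewrite mulrCA.
    rewrite ler_sum// => j _; rewrite (ler_wpM2l (ltW (h_gt0 j)))//.
    by rewrite -lee_fin sumM_fineK ?sumM_ub//; exact: xB.
  by rewrite ltry.
rewrite sqr_sqrtr ?fine_ge0 ?sumM_ge0//.
by rewrite -lee_fin sumM_fineK// sumM_ub.
Qed.

Lemma spaceB_sum N (c : M -> R[i]) :
  spaceB M_ e B (\sum_(n <- M_ N) c n *: e n).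
Proof.
move=> j; rewrite (@sumM_supp _ _ _ M_nested _ _ N) ?ltry// => n.
  by rewrite mulr_ge0 ?sqr_ge0.
by move=> /negbTE nN; rewrite inner_sum_basis// nN rnorm0 expr0n mul0r.
Qed.

Lemma seminormB_sum N (c : M -> R[i]) :
  seminormB M_ e B h (\sum_(n <- M_ N) c n *: e n) =
  Num.sqrt (\sum_(n <- M_ N) rnorm (c n) ^+ 2 * b n).
Proof.
congr Num.sqrt; apply: EFin_inj; rewrite (@sumM_supp _ _ _ M_nested _ _ N)//.
  congr EFin; apply: eq_big_seq => n nN.
  by rewrite inner_sum_basis// nN.
by move=> n /negbTE nN; rewrite inner_sum_basis// nN rnorm0 expr0n mul0r.
Qed.

(** * The functional [g] on projections and on the extremal sequence *)

Section Functional.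
Context {X : normedModType R[i]} {A : linop H X} {f : {linear X -> R[i]^o}}.
Hypothesis A_dom : forall n, opdom A (e n).

Local Notation g := (comp_op f A).
Local Notation w n := (rnorm (g (e n)) ^+ 2 / b n).

Let w_ge0 n : 0 <= w n.
Proof. by rewrite divr_ge0 ?sqr_ge0 ?bcoef_ge0. Qed.

Lemma comp_op_sum N (c : M -> R[i]) :
  g (\sum_(n <- M_ N) c n *: e n) = \sum_(n <- M_ N) c n * g (e n).
Proof. exact: (@linop_sum _ _ _ g _ _ _ _ A_dom).2. Qed.

Lemma extremal_seqE N : extremal_seq M_ e B A f h N =
  \sum_(n <- M_ N) ((g (e n) : R[i])^* / (b n)%:C%C) *: e n.
Proof.
rewrite /extremal_seq big_mkcond/=; apply: eq_bigr => n _.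
by case: eqVneq => //= ->; rewrite invr0 mulr0 scale0r.
Qed.

(** The conjugates in the coefficients make every term of [g (x_ N)] the nonnegative real [w n], so
    the norm of the sum is the sum itself. *)
Lemma comp_op_extremal_seq N :
  rnorm (g (extremal_seq M_ e B A f h N)) = \sum_(n <- M_ N) w n.
Proof.
rewrite extremal_seqE comp_op_sum -[RHS]rnormC ?sumr_ge0//.
rewrite rmorph_sum/=; congr rnorm; apply: eq_bigr => n _.
by rewrite mulrAC mulcJ_rnorm fmorph_div.
Qed.

Lemma seminormB_extremal_seq N :
  seminormB M_ e B h (extremal_seq M_ e B A f h N) =
  Num.sqrt (\sum_(n <- M_ N) w n).
Proof.
rewrite extremal_seqE seminormB_sum; congr Num.sqrt; apply: eq_bigr => n _.
rewrite rnormM rnormJ -fmorphV/= rnormC ?invr_ge0 ?bcoef_ge0//.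
by have [->|b0] := eqVneq (b n) 0; [rewrite invr0 !mulr0|field].
Qed.

Lemma rnorm_comp_op_proj_le x N (W : R) : spaceB M_ e B x ->
  (forall n, b n = 0 -> g (e n) = 0) -> \sum_(n <- M_ N) w n <= W ->
  rnorm (g (proj e (M_ N) x)) <= Num.sqrt W * seminormB M_ e B h x.
Proof.
move=> xB g0 wW; rewrite comp_op_sum (le_trans (ler_rnorm_sum _ _))//.
under eq_bigr do rewrite rnormM.
have W0 : 0 <= W by rewrite (le_trans _ wW)// sumr_ge0.
rewrite -(@ler_pXn2r _ 2)// ?nnegrE ?mulr_ge0 ?sqrtr_ge0 ?sumr_ge0//; last first.
  by move=> n _; rewrite mulr_ge0 ?rnorm_ge0.
rewrite exprMn sqr_sqrtr//.
(* The factor [Num.sqrt (b n)] is split off so that the squares of [u] sum to the partial sum of the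
   constant and those of [v] to that of the squared seminorm. Where [b n] is 0, the product survives
   the splitting because [g (e n)] is 0. *)
pose u n := rnorm (g (e n)) / Num.sqrt (b n).
pose v n := rnorm (inner x (e n)) * Num.sqrt (b n).
have -> : \sum_(n <- M_ N) rnorm (inner x (e n)) * rnorm (g (e n)) =
          \sum_(n <- M_ N) u n * v n.
  apply: eq_bigr => n _; rewrite /u /v.
  have [bn|bn] := eqVneq (b n) 0.
    by rewrite g0// bn sqrtr0 !mulr0 rnorm0 mulr0.
  have : Num.sqrt (b n) != 0 by rewrite gt_eqF// sqrtr_gt0 lt0r bn bcoef_ge0.
  by move=> sb; field.
rewrite (le_trans (sum_CauchySchwarz _ _ _))// ler_pM ?sumr_ge0//.
- by move=> n _; rewrite sqr_ge0.
- by move=> n _; rewrite sqr_ge0.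
- under eq_bigr do rewrite /u expr_div_n sqr_sqrtr ?bcoef_ge0//.
  exact: wW.
- under eq_bigr do rewrite /v exprMn sqr_sqrtr ?bcoef_ge0//.
  exact: seminormB_ub.
Qed.

Lemma bcoef_eq0_comp_op n : (fA_tsum M_ e B A f (fun=> 1%R) < +oo)%E ->
  b n = 0 -> g (e n) = 0.
Proof.
move=> fA_sum bn; apply/eqP; rewrite -rnorm_eq0 -sqrf_eq0; apply/eqP.
apply: (tsum_lty fA_sum); apply/eqP; rewrite eq_le.
by have := bcoef1_le n; rewrite bn mulr0 => ->; rewrite sumr_ge0// => j _;
  rewrite mulr_ge0 ?sqr_ge0.
Qed.

Lemma fA_tsumE : (fA_tsum M_ e B A f (fun=> 1%R) < +oo)%E ->
  fA_tsum M_ e B A f h = sumM M_ predT (fun n => w n).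
Proof.
move=> fA_sum; apply: tsumE => n bn.
by apply/eqP; rewrite sqrf_eq0 rnorm_eq0; exact/eqP/bcoef_eq0_comp_op.
Qed.

(** By [bcoef1_le], each term is at most the sum of the inverses of the [h j] times the
    corresponding term for unit weights. *)
Lemma fA_tsum_lty : (fA_tsum M_ e B A f (fun=> 1%R) < +oo)%E ->
  (fA_tsum M_ e B A f h < +oo)%E.
Proof.
move=> fA_sum; rewrite fA_tsumE//.
pose w1 n := rnorm (g (e n)) ^+ 2 / bcoef e B (fun=> 1) n.
have b1_ge0 n : 0 <= bcoef e B (fun=> 1) n.
  by rewrite sumr_ge0// => j _; rewrite mulr_ge0 ?sqr_ge0.
have w1_ge0 n : 0 <= w1 n by rewrite divr_ge0 ?sqr_ge0.
have w1_lty : (sumM M_ predT w1 < +oo)%E.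
  move: (fA_sum); rewrite /fA_tsum tsumE// => n b1n.
  exact: (tsum_lty fA_sum b1n).
set C := \sum_j (h j)^-1.
have C0 : 0 <= C by rewrite sumr_ge0// => j _; rewrite invr_ge0 ltW.
apply: (@le_lt_trans _ _ (C * fine (sumM M_ predT w1))%:E); last by rewrite ltry.
apply: sumM_lub => // N.
apply: (@le_trans _ _ (C * \sum_(n <- M_ N) w1 n)); last first.
  by rewrite ler_wpM2l// -lee_fin sumM_fineK// sumM_ub.
rewrite mulr_sumr ler_sum// => n _; rewrite /w1.
(* Comparing the quotients requires positive denominators. If [b n] is 0 the left side is a quotient
   by 0; if the unit weight is 0, finiteness of the assumed sum kills the numerator. *)
have [bn|bn] := eqVneq (b n) 0.
  by rewrite bn invr0 mulr0 mulr_ge0 ?divr_ge0 ?sqr_ge0.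
have [b1n|b1n] := eqVneq (bcoef e B (fun=> 1) n) 0.
  by rewrite (tsum_lty fA_sum b1n) !mul0r mulr0.
rewrite mulrCA ler_wpM2l ?sqr_ge0//.
rewrite ler_pdivlMr ?lt0r ?b1n ?b1_ge0// mulrC ler_pdivrMr ?lt0r ?bn ?bcoef_ge0//.
exact: bcoef1_le.
Qed.

End Functional.
End Seminorm.

(** * The inequality, its sharpness and the extremal sequence *)

Theorem theorem2 (R : realType) (H H' : hilbertType R)
  (M : countType) (M_ : nat -> {fset M}) (e : M -> H)
  (M_nested : forall N, (M_ N `<=` M_ N.+1)%fset)
  (M_union : forall n : M, exists N, n \in M_ N)
  (e_basis : orthonormal_basis e)
  (m : nat) (B : 'I_m.+1 -> linop H H')
  (B_closed : forall j, closed_op (B j))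
  (B_dom : forall n j, opdom (B j) (e n))
  (B_orth : forall j n' n'', n' != n'' -> inner (B j (e n')) (B j (e n'')) = 0)
  (B_neq0 : exists j0 n0, B j0 (e n0) != 0)
  (X : normedModType R[i]) (A : linop H X) (f : {linear X -> R[i]^o})
  (f_bounded : exists c : R, forall x, rnorm (f x) <= c * rnorm x)
  (A_dom : forall n, opdom A (e n))
  (fA_neq0 : exists n0, f (A (e n0)) != 0)
  (fA_closable : closable (comp_op f A))
  (fA_sum : (fA_tsum M_ e B A f (fun=> 1%R) < +oo)%E)
  (h : 'I_m.+1 -> R) (h_gt0 : forall j, 0 < h j) :
  let K := sqrte (fA_tsum M_ e B A f h) in
  let D := opdom A `&` spaceB M_ e B in
  let x_ := extremal_seq M_ e B A f h in
  [/\ forall x, D x ->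
        ((rnorm (f (A x)))%:E <= K * (seminormB M_ e B h x)%:E)%E,
      forall c : R,
        (forall x, D x -> rnorm (f (A x)) <= c * seminormB M_ e B h x) ->
        (K <= c%:E)%E,
      forall N, D (x_ N),
      \forall N \near \oo, seminormB M_ e B h (x_ N) != 0
    & (rnorm (f (A (x_ N))) / seminormB M_ e B h (x_ N))%:E @[N --> \oo] --> K].
Proof.
move=> K D x_.
pose g := comp_op f A.
pose w n := rnorm (g (e n)) ^+ 2 / bcoef e B h n.
have w_ge0 n : 0 <= w n by rewrite divr_ge0 ?sqr_ge0 ?bcoef_ge0.
have SE := fA_tsumE h_gt0 fA_sum.
set S := fine (fA_tsum M_ e B A f h).
have S_E : fA_tsum M_ e B A f h = S%:E.
  by rewrite /S SE sumM_fineK// -SE fA_tsum_lty.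
have S_ub N : \sum_(n <- M_ N) w n <= S.
  by rewrite -lee_fin -S_E SE sumM_ub.
have S_cvg : Num.sqrt (\sum_(n <- M_ N) w n) @[N --> \oo] --> Num.sqrt S.
  apply: (cvg_comp _ Num.sqrt _ (@sqrt_continuous _ S)).
  have := sumM_cvg M_nested w_ge0; rewrite -/w -SE S_E.
  by move=> /fine_cvg.
have KE : K = (Num.sqrt S)%:E by rewrite /K S_E.
have w_gt0 : \forall N \near \oo, 0 < \sum_(n <- M_ N) w n.
  (* From some [N] on, [M_ N] contains an index [n0] with [g (e n0)] nonzero. Its weight is then
     nonzero too, so its term is positive. *)
  have [n0 gn0] := fA_neq0; have [N0 nN0] := M_union n0.
  near=> N; apply: (@lt_le_trans _ _ (w n0)).
    rewrite divr_gt0 ?exprn_gt0// lt0r ?rnorm_ge0 ?rnorm_eq0 ?gn0//.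
    rewrite bcoef_ge0// andbT; apply: contraNneq gn0 => b0.
    exact/eqP/(bcoef_eq0_comp_op h_gt0 fA_sum b0).
  have nN : n0 \in M_ N.
    apply: fsubsetP nN0; apply: nested_subset => //.
    by near: N; exact: nbhs_infty_ge.
  by rewrite (big_fsetD1 n0)//= lerDl sumr_ge0.
have ratio N :
    rnorm (f (A (x_ N))) / seminormB M_ e B h (x_ N) =
    Num.sqrt (\sum_(n <- M_ N) w n).
  rewrite [f _](_ : _ = g (x_ N))// comp_op_extremal_seq//.
  rewrite seminormB_extremal_seq//.
  have s0 : 0 <= \sum_(n <- M_ N) w n by rewrite sumr_ge0.
  (* The ratio is [s / Num.sqrt s], which equals [Num.sqrt s] even at [s = 0], where the quotient is
     0. The identity thus holds for every [N]. *)
  have [->|sN0] := eqVneq (\sum_(n <- M_ N) w n) 0; first by rewrite sqrtr0 mul0r.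
  rewrite -{1}(sqr_sqrtr s0) expr2 mulfK//.
  by rewrite gt_eqF// sqrtr_gt0 lt0r sN0.
have semi_neq0 : \forall N \near \oo, seminormB M_ e B h (x_ N) != 0.
  near=> N; rewrite seminormB_extremal_seq// gt_eqF// sqrtr_gt0.
  by near: N.
have D_x N : D (x_ N).
  rewrite /x_ extremal_seqE; split; last exact: spaceB_sum.
  exact: (linop_sum (M_ N) _ A_dom).1.
split=> //.
- move=> x [xA xB]; rewrite KE -EFinM lee_fin.
  have [d d0 gd] := closable_functional_bounded fA_closable.
  have dE : d = (complex.Re d)%:C%C by rewrite RRe_real// gtr0_real.
  have {}d0 : 0 < complex.Re d by rewrite -ltcR -dE.
  (* Since [d * |g y| <= |y|] on the domain, a projection error below [d * eps] changes [g] by at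
     most [eps]. *)
  apply/ler_addgt0Pr => eps eps0.
  have [N xN] := proj_cvg e_basis M_nested M_union x (mulr_gt0 d0 eps0).
  have [pA _] := linop_sum (M_ N) (fun n => inner x (e n)) A_dom.
  have [yA gy] := @linopB _ _ _ g _ _ xA pA.
  rewrite [f _](_ : _ = g x)// -[g x](subrK (g (proj e (M_ N) x))).
  rewrite (le_trans (ler_rnormD _ _))// addrC lerD//.
    apply: (rnorm_comp_op_proj_le M_nested h_gt0 A_dom xB _ (S_ub N)) => n.
    exact: (bcoef_eq0_comp_op h_gt0 fA_sum).
  rewrite -gy -(ler_pM2l d0) (le_trans _ (ltW xN))//.
  by rewrite -lecR rmorphM/= !rnormE -dE gd.
(* For large [N] the seminorm of [x_ N] is positive, so [c] bounds the ratio at [x_ N], whose limit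
   is [Num.sqrt S]. *)
- move=> c cP; rewrite KE lee_fin; apply: (cvgr_to_le S_cvg).
  near=> N; rewrite -ratio ler_pdivrMr; first exact: cP.
  rewrite lt0r sqrtr_ge0 andbT.
  by near: N.
- rewrite KE; under eq_fun do rewrite ratio.
  by apply: cvg_EFin => //; apply: nearW.
Unshelve. all: by end_near. Qed.
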